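(* On a paraquaternionic manifold $M$ of dimension $4n\ge 8$, the almost paracomplex structure $\mathbb P_1$ on the reflector space $Z^+$ and the almost complex structure $\mathbb J_1$ on the twistor space $Z^-$, both constructed from the horizontal distribution of a torsion-free paraquaternionic connection, are always integrable.
   Context: An almost paraquaternionic structure on a $4n$-manifold $M$ is a rank-3 subbundle $\mathcal P\subset\mathrm{End}(TM)$ locally spanned by triples $(J_1,J_2,J_3)$ with $J_1^2=J_2^2=-J_3^2=\mathrm{id}$, $J_1J_2=-J_2J_1=J_3$. A linear connection on $TM$ is paraquaternionic if it preserves $\mathcal P$; $M$ is paraquaternionic if it has a torsion-free paraquaternionic connection $\nabla$. The bundle $\mathcal P$ carries the Lorentz metric of signature $(+,+,-)$ for which the local bases $(J_1,J_2,J_3)$ are orthonormal, and any paraquaternionic connection preserves it. $Z^{+}$ (resp. $Z^{-}$) is the bundle over $M$, with projection $\pi$, whose fibre over $p$ consists of the $S=xJ_1+yJ_2+zJ_3\in\mathcal P_p$ with $x^2+y^2-z^2=1$, i.e. $S^2=\mathrm{id}$ (resp. $x^2+y^2-z^2=-1$, i.e. $S^2=-\mathrm{id}$). The connection $\nabla$ induces a splitting $TZ^{\pm}=\mathbb H^{\pm}\oplus\mathbb V^{\pm}$, where $\mathbb V^\pm$ is tangent to the fibres and $\mathbb H^\pm$ is the horizontal distribution. A vertical vector at $S$ is identified with an element $X\in\mathcal P_{\pi(S)}$ orthogonal to $S$; the fibre structure ($\tilde P$ on $\mathbb V^+$, $\tilde J$ on $\mathbb V^-$) is $X\mapsto S\times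 X=SX$, where for $X=\sum x^iJ_i$, $Y=\sum y^kJ_k$ one sets $X\times Y=\sum_{i\ne k}x^iy^kJ_iJ_k$. On $\mathbb H^\pm_S\cong T_{\pi(S)}M$ let $\bar P$ (resp. $\bar J$) be the lift of the endomorphism $S$ itself. Then $\mathbb P_1$ is the almost paracomplex structure on $Z^+$ equal to $\tilde P$ on $\mathbb V^+$ and to $\bar P$ on $\mathbb H^+$, and $\mathbb J_1$ is the almost complex structure on $Z^-$ equal to $\tilde J$ on $\mathbb V^-$ and to $\bar J$ on $\mathbb H^-$. Integrability means vanishing of the Nijenhuis tensor. *)

(* Defs.v *)
From mathcomp Require Import all_boot all_order all_algebra.
From mathcomp Require Import all_classical all_reals all_analysis.

Set Implicit Arguments.
Unset Strict Implicit.
Unset Printing Implicit Defensive.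

Import Order.TTheory GRing.Theory Num.Theory.
Import numFieldNormedType.Exports.
Local Open Scope classical_set_scope.
Local Open Scope ring_scope.

(* Smooth calculus on open subsets of finite-dimensional normed spaces.
   Only used with [U] open, so that ['D_v f x] with [x] in [U] depends only on
   the restriction of [f] to [U]. *)
Fixpoint Ck (R : realType) (V W : normedModType R) (k : nat) (U : set V)
    (f : V -> W) : Prop :=
  match k with
  | 0%N => forall x, U x -> {for x, continuous f}
  | k'.+1 => (forall x, U x -> differentiable f x) /\
             (forall v : V, Ck k' U (fun x => 'D_v f x))
  end.

Definition smooth (R : realType) (V W : normedModType R) (U : set V)
    (f : V -> W) : Prop := forall k, Ck k U f.

Definition lie_bracket (R : realType) (V : normedModType R) (X Y : V -> V)
    (x : V) : V := 'D_(X x) Y x - 'D_(Y x) X x.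

(* [coord i] and [cinv i] are only meaningful on [dom i] and its image. *)
Record atlas (R : realType) (m : nat) (M : topologicalType) := Atlas {
  chart : Type;
  dom : chart -> set M;
  coord : chart -> M -> 'cV[R]_m;
  cinv : chart -> 'cV[R]_m -> M;
  dom_open : forall i, open (dom i);
  dom_cover : forall p, exists i, dom i p;
  image_open : forall i, open (coord i @` dom i);
  coordK : forall i p, dom i p -> cinv i (coord i p) = p;
  coord_continuous : forall i p, dom i p -> {for p, continuous (coord i)};
  cinv_continuous : forall i x, (coord i @` dom i) x ->
    {for x, continuous (cinv i)};
  transition_smooth : forall i j,
    smooth (coord i @` (dom i `&` dom j)) (coord j \o cinv i) }.

Definition chart_image (R : realType) (m : nat) (M : topologicalType)
    (at_ : atlas R m M) (i : chart at_) : set 'cV[R]_m := coord i @` dom i.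

(* Tangent vectors at [p] are represented by their components in the charts
   around [p]; [dtrans i j p] converts [i]-components to [j]-components. *)
Definition dtrans (R : realType) (m : nat) (M : topologicalType)
    (at_ : atlas R m M) (i j : chart at_) (p : M) (v : 'cV[R]_m) : 'cV[R]_m :=
  'D_v (coord j \o cinv i) (coord i p).

Definition pq_triple (R : realType) (m : nat) (J1 J2 J3 : 'M[R]_m) : Prop :=
  [/\ J1 *m J1 = 1%:M, J2 *m J2 = 1%:M, J3 *m J3 = - 1%:M,
      J1 *m J2 = J3 & J2 *m J1 = - J3].

Definition pq_basis (R : realType) (m : nat) (Q : set 'M[R]_m)
    (J1 J2 J3 : 'M[R]_m) : Prop :=
  pq_triple J1 J2 J3 /\
  forall A, Q A <-> exists x y z : R, A = x *: J1 + y *: J2 + z *: J3.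

(* [fibre i x] is the fibre of the subbundle of End(TM) at the point with
   [i]-coordinates [x], written in the coordinate frame of the chart [i].  In
   [fibre_compat], [A] and [B] are the matrices of one endomorphism of the
   tangent space in the two charts.  The spanning triples of [fibre_frame] are
   automatically linearly independent (for [0 < m]), so the rank is 3. *)
Record paraquaternionic_structure (R : realType) (m : nat)
    (M : topologicalType) (at_ : atlas R m M) := ParaquaternionicStructure {
  fibre : chart at_ -> 'cV[R]_m -> set 'M[R]_m;
  fibre_compat : forall (i j : chart at_) (p : M) (A B : 'M[R]_m),
    dom i p -> dom j p ->
    (forall v, B *m dtrans i j p v = dtrans i j p (A *m v)) ->
    fibre i (coord i p) A -> fibre j (coord j p) B;
  fibre_frame : forall (i : chart at_) (x : 'cV[R]_m), chart_image i x ->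
    exists (U : set 'cV[R]_m) (J1 J2 J3 : 'cV[R]_m -> 'M[R]_m),
      [/\ open U, U x & U `<=` chart_image i] /\
      [/\ smooth U J1, smooth U J2, smooth U J3 &
          forall y, U y -> pq_basis (fibre i y) (J1 y) (J2 y) (J3 y)] }.

(* [conn_form G x v] is the matrix at [v] of the connection form with
   Christoffel symbols [(G x a) c b] = Gamma^c_{ab}. *)
Definition conn_form (R : realType) (m : nat)
    (G : 'cV[R]_m -> 'I_m -> 'M[R]_m) (x v : 'cV[R]_m) : 'M[R]_m :=
  \sum_(a < m) v a 0 *: G x a.

Definition cov_vect (R : realType) (m : nat)
    (G : 'cV[R]_m -> 'I_m -> 'M[R]_m) (v : 'cV[R]_m)
    (Y : 'cV[R]_m -> 'cV[R]_m) (x : 'cV[R]_m) : 'cV[R]_m :=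
  'D_v Y x + conn_form G x v *m Y x.

(* The induced derivative on End(TM), by the Leibniz rule. *)
Definition cov_endo (R : realType) (m : nat)
    (G : 'cV[R]_m -> 'I_m -> 'M[R]_m) (v : 'cV[R]_m)
    (A : 'cV[R]_m -> 'M[R]_m) (x : 'cV[R]_m) : 'M[R]_m :=
  'D_v A x + (conn_form G x v *m A x - A x *m conn_form G x v).

(* [connection_compat]: the covariant derivative of a vector field (with
   components [Y] and [Y'] in the charts [i] and [j]) is chart-independent. *)
Record linear_connection (R : realType) (m : nat) (M : topologicalType)
    (at_ : atlas R m M) := LinearConnection {
  christoffel : chart at_ -> 'cV[R]_m -> 'I_m -> 'M[R]_m;
  christoffel_smooth : forall i a,
    smooth (chart_image i) (fun x => christoffel i x a);
  connection_compat : forall (i j : chart at_) (Y Y' : 'cV[R]_m -> 'cV[R]_m),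
    smooth (coord i @` (dom i `&` dom j)) Y ->
    smooth (coord j @` (dom i `&` dom j)) Y' ->
    (forall p, dom i p -> dom j p ->
       Y' (coord j p) = dtrans i j p (Y (coord i p))) ->
    forall p v, dom i p -> dom j p ->
      cov_vect (christoffel j) (dtrans i j p v) Y' (coord j p) =
      dtrans i j p (cov_vect (christoffel i) v Y (coord i p)) }.

Definition torsion_free (R : realType) (m : nat) (M : topologicalType)
    (at_ : atlas R m M) (D : linear_connection at_) : Prop :=
  forall (i : chart at_) (U : set 'cV[R]_m) (X Y : 'cV[R]_m -> 'cV[R]_m),
    open U -> U `<=` chart_image i -> smooth U X -> smooth U Y ->
    forall x, U x ->
      cov_vect (christoffel D i) (X x) Y x -
      cov_vect (christoffel D i) (Y x) X x = lie_bracket X Y x.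

Definition paraquaternionic_connection (R : realType) (m : nat)
    (M : topologicalType) (at_ : atlas R m M)
    (P : paraquaternionic_structure at_) (D : linear_connection at_) : Prop :=
  forall (i : chart at_) (U : set 'cV[R]_m) (A : 'cV[R]_m -> 'M[R]_m),
    open U -> U `<=` chart_image i -> smooth U A ->
    (forall x, U x -> fibre P i x (A x)) ->
    forall x v, U x -> fibre P i x (cov_endo (christoffel D i) v A x).

(* Over the chart [i], the total space of End(TM) has coordinates [(x, A)] in
   [endo_coord R m], and its tangent vectors have components [(v, B)] in the
   same space.  The reflector space Z^+ ([eps = 1]) and the twistor space Z^-
   ([eps = -1]) are submanifolds of this total space. *)
Definition endo_coord (R : realType) (m : nat) : normedModType R :=
  ('cV[R]_m * 'M[R]_m)%type.

Definition Zspace (R : realType) (m : nat) (M : topologicalType)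
    (at_ : atlas R m M) (P : paraquaternionic_structure at_) (eps : R)
    (i : chart at_) : set (endo_coord R m) :=
  [set s | chart_image i s.1 /\ exists (J1 J2 J3 : 'M[R]_m) (x y z : R),
     [/\ pq_basis (fibre P i s.1) J1 J2 J3,
         s.2 = x *: J1 + y *: J2 + z *: J3 &
         x ^+ 2 + y ^+ 2 - z ^+ 2 = eps]].

(* Velocity at [s] of a smooth curve in [Z]. *)
Definition tangent (R : realType) (m : nat) (Z : set (endo_coord R m))
    (s w : endo_coord R m) : Prop :=
  exists (e : R) (c : R -> endo_coord R m),
    [/\ 0 < e, smooth `]- e, e[%classic c,
        (forall t, `]- e, e[%classic t -> Z (c t)), c 0 = s & 'D_1 c 0 = w].

(* The velocity at [s] of a section of End(TM) that passes through [s] and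
   whose covariant derivative along [v] vanishes there, cf. [cov_endo]. *)
Definition hlift (R : realType) (m : nat)
    (G : 'cV[R]_m -> 'I_m -> 'M[R]_m) (s : endo_coord R m) (v : 'cV[R]_m) :
    endo_coord R m :=
  (v, - (conn_form G s.1 v *m s.2 - s.2 *m conn_form G s.1 v)).

(* The component of [w] in the fibre direction, [w = hlift w.1 + (0, vpart w)];
   for [w] tangent to Z it is an element of the fibre of P orthogonal to s. *)
Definition vpart (R : realType) (m : nat)
    (G : 'cV[R]_m -> 'I_m -> 'M[R]_m) (s w : endo_coord R m) : 'M[R]_m :=
  w.2 - (hlift G s w.1).2.

(* With [S := s.2]: the lift of S on the horizontal part, X |-> S X on the
   vertical part.  This is P_1 on Z^+ and J_1 on Z^-. *)
Definition bundle_struct (R : realType) (m : nat)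
    (G : 'cV[R]_m -> 'I_m -> 'M[R]_m) (s w : endo_coord R m) :
    endo_coord R m :=
  hlift G s (s.2 *m w.1) + (0, s.2 *m vpart G s w).

(* Nijenhuis bracket of [F], where [F^2 = eps id]; [F], [X] and [Y] are given on
   an open subset of the ambient space. *)
Definition nijenhuis (R : realType) (V : normedModType R) (eps : R)
    (F : V -> V -> V) (X Y : V -> V) (s : V) : V :=
  let FX := fun u => F u (X u) in
  let FY := fun u => F u (Y u) in
  lie_bracket FX FY s - F s (lie_bracket FX Y s) - F s (lie_bracket X FY s)
  + eps *: lie_bracket X Y s.

(* Vanishing of the Nijenhuis tensor on Z^+ or Z^-.  A smooth vector field on
   an open subset of Z is locally the restriction of a smooth ambient field
   that is tangent to Z along Z. *)
Definition structure_integrable (R : realType) (m : nat) (M : topologicalType)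
    (at_ : atlas R m M) (P : paraquaternionic_structure at_)
    (D : linear_connection at_) (eps : R) : Prop :=
  forall (i : chart at_) (W : set (endo_coord R m))
      (X Y : endo_coord R m -> endo_coord R m),
    open W -> smooth W X -> smooth W Y ->
    (forall s, W s -> Zspace P eps i s -> tangent (Zspace P eps i) s (X s)) ->
    (forall s, W s -> Zspace P eps i s -> tangent (Zspace P eps i) s (Y s)) ->
    forall s, W s -> Zspace P eps i s ->
      nijenhuis eps (bundle_struct (christoffel D i)) X Y s = 0.

(* Main.v *)
Require Import Defs.
From mathcomp Require Import all_boot all_order all_algebra.
From mathcomp Require Import all_classical all_reals all_analysis.
From mathcomp Require Import ring lra ssrAC.
Import Order.TTheory GRing.Theory Num.Theory.
Import numFieldNormedType.Exports.
Local Open Scope classical_set_scope.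
Local Open Scope ring_scope.
Set Implicit Arguments.
Unset Strict Implicit.
Unset Printing Implicit Defensive.

(* At a point [s = (x, A)] of Z one has [A ^ 2 = eps], and the bundle structure
   squares to [eps] on the whole tangent space of End(TM) there, not only on
   vectors tangent to Z.  Hence the Nijenhuis bracket is tensorial in the
   ambient space, and, the torsion being zero, it takes [(u, _)] and [(v, _)]
   to the vertical vector [- K u v], where
     K u v = [R(Au, Av), A] - A [R(Au, v), A] - A [R(u, Av), A]
             + eps [R(u, v), A].
   As the connection preserves P, [K u v] lies in P; it anticommutes with [A],
   so that [B (K u v) = a + b A] for an invertible [B] in P anticommuting with
   [A].  Moreover [K (Au) v = (K u v) A], and the first Bianchi identity for
   [R] makes the cyclic sum of [(K u v) w] vanish.  Tracing that sum over [w]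
   gives [(m - 4) tr (B (K u v)) = 0], with [m = dim M > 4], whence [K = 0]. *)

(** * Traces and the vanishing of cyclic forms *)

Lemma linear_delta_sum (R : realType) m (f : 'cV[R]_m -> R) :
  (forall a u v, f (a *: u + v) = a * f u + f v) ->
  forall u : 'cV[R]_m, \sum_k (f (delta_mx k 0) * u k 0) = f u.
Proof.
move=> lf u; have f0 : f 0 = 0.
  by have := lf 1 0 0; rewrite scaler0 add0r; lra.
have fS (r : seq 'I_m) (c : 'I_m -> R) (h : 'I_m -> 'cV[R]_m) :
    f (\sum_(k <- r) c k *: h k) = \sum_(k <- r) c k * f (h k).
  by elim: r => [|k r IH]; rewrite ?big_nil ?f0// !big_cons lf IH.
have -> : f u = f (\sum_k u k 0 *: delta_mx k 0).
  congr f; rewrite [LHS]matrix_sum_delta.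
  by apply: eq_bigr => k _; rewrite big_ord1.
by rewrite fS; apply: eq_bigr => k _; rewrite mulrC.
Qed.

(** As [B *m K u v] lies in the span of [1] and [A], it is determined by the single scalar form
    [t u v = \tr (B *m K u v)]. The cyclic identity thus becomes a relation among vectors with
    coefficients in [t], which can be traced. *)
Lemma cyclic_form_eq0 (R : realType) m (A B : 'M[R]_m) (eps dl : R)
    (K : 'cV[R]_m -> 'cV[R]_m -> 'M[R]_m) :
  (4 < m)%N -> eps * eps = 1 -> dl != 0 ->
  A *m A = eps%:M -> B *m B = dl%:M -> A *m B = - (B *m A) ->
  (forall a u u' v, K (a *: u + u') v = a *: K u v + K u' v) ->
  (forall u v, K v u = - K u v) ->
  (forall u v, K (A *m u) v = K u v *m A) ->
  (forall u v, exists a b, B *m K u v = a%:M + b *: A) ->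
  (forall u v w, K u v *m w + K v w *m u + K w u *m v = 0) ->
  forall u v, K u v = 0.
Proof.
move=> m4 eps1 dl0 AA BB AB Kl Ka KA KB Kc.
have mn0 : m%:R != 0 :> R by rewrite pnatr_eq0; case: (m) m4.
(* Conjugation by the invertible [B] turns [A] into [- A]. *)
have trA : \tr A = 0.
  have : \tr (A *m B *m B) = - \tr (A *m B *m B).
    rewrite {1}AB mulNmx raddfN/= -(mulmxA B). by rewrite mxtrace_mulC.
  rewrite -mulmxA BB mul_mx_scalar mxtraceZ => h.
  have : dl * \tr A = 0 by lra.
  by move/eqP; rewrite mulf_eq0 (negPf dl0)/= => /eqP.
pose t u v := \tr (B *m K u v).
have tl a u u' v : t (a *: u + u') v = a * t u v + t u' v.
  by rewrite /t Kl mulmxDr -scalemxAr mxtraceD mxtraceZ.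
have ta u v : t v u = - t u v by rewrite /t Ka mulmxN raddfN.
(* Since [A] is traceless, the traces of [B *m K u v] and of its product with [A] read off the
   coefficients [a] and [b], up to the factor [m]. *)
have tE u v : m%:R *: (B *m K u v) = (t u v)%:M + (eps * t (A *m u) v) *: A.
  have [a [b E]] := KB u v.
  rewrite /t KA mulmxA E mulmxDl mul_scalar_mx -scalemxAl AA.
  rewrite !mxtraceD !mxtraceZ.
  rewrite !mxtrace_scalar trA !mulr0 addr0 add0r -mulr_natl.
  rewrite scalerDr scalerA scale_scalar_mx mulrCA.
  rewrite !mulr1 mulr_natl; congr (_ + _ *: _).
  by rewrite -(mulr_natr eps) mulrA mulrA -(mulrA b) eps1 mulr1 mulrC.
have t0 v : t 0 v = 0.
  by have := tl 1 0 0 v; rewrite scaler0 add0r; lra.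
have tZ a u v : t (a *: u) v = a * t u v by rewrite -[_ *: u]addr0 tl t0 addr0.
have tAA u v : t (A *m (A *m u)) v = eps * t u v.
  by rewrite mulmxA AA mul_scalar_mx tZ.
have tAr u v : t u (A *m v) = t (A *m u) v.
  by rewrite ta /t !KA Ka mulNmx mulmxN raddfN opprK.
have tr1 a u (v : 'cV[R]_m) :
    \sum_k (t u (delta_mx k 0) * (a *: v) k 0) = a * t u v.
  rewrite (linear_delta_sum (f := t u)) => [|c w w' ].
    by rewrite ta tZ [in RHS]ta mulrN.
  by rewrite ta tl opprD -mulrN -!ta.
have tr2 a u (v : 'cV[R]_m) :
    \sum_k (t (A *m delta_mx k 0) u * (a *: v) k 0) = a * t (A *m v) u.
  rewrite (linear_delta_sum (f := fun w => t (A *m w) u)) => [|c w w' ].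
    by rewrite -scalemxAr tZ.
  by rewrite mulmxDr -scalemxAr tl.
have cyc u v w : t u v *: w + (eps * t (A *m u) v) *: (A *m w)
    + (t v w *: u + (eps * t (A *m v) w) *: (A *m u))
    + (t w u *: v + (eps * t (A *m w) u) *: (A *m v)) = 0.
  have := congr1 (fun z => m%:R *: (B *m z)) (Kc u v w).
  rewrite mulmx0 scaler0 => <-.
  have KE u' v' w' : m%:R *: (B *m (K u' v' *m w')) =
      t u' v' *: w' + (eps * t (A *m u') v') *: (A *m w').
    by rewrite mulmxA scalemxAl tE mulmxDl mul_scalar_mx -scalemxAl.
  by rewrite !mulmxDr !scalerDr !KE.
(* the trace of [cyc] over [w] *)
have t00 u v : t u v = 0.
  pose w k : 'cV[R]_m := delta_mx k 0.
  have S1 : \sum_k (t u v * w k k 0) = m%:R * t u v.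
    rewrite -mulr_sumr (eq_bigr (fun=> 1)) => [|k _]; last by rewrite mxE !eqxx.
    by rewrite sumr_const card_ord mulrC.
  have S2 : \sum_k (eps * t (A *m u) v * (A *m w k) k 0) = 0.
    rewrite -mulr_sumr (eq_bigr (fun k => A k k)) => [|k _]; last first.
      by rewrite -colE mxE.
    by rewrite -/(\tr A) trA mulr0.
  have S3 := tr1 1 v u; have S4 := tr1 eps (A *m v) (A *m u).
  have S5 : \sum_k (t (w k) u * v k 0) = t v u.
    by rewrite (linear_delta_sum (f := t^~ u)).
  have S6 := tr2 eps u (A *m v).
  rewrite mul1r !scale1r in S3; rewrite tAA in S6; rewrite tAr tAA in S4.
  have : \sum_k (0 : 'cV[R]_m) k 0 = 0 by rewrite big1// => k _; rewrite mxE.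
  under eq_bigr => k _ do rewrite -(cyc u v (w k)).
  rewrite (eq_bigr (fun k => t u v * w k k 0
      + eps * t (A *m u) v * (A *m w k) k 0
      + (t v (w k) * u k 0 + t (A *m v) (w k) * (eps *: (A *m u)) k 0)
      + (t (w k) u * v k 0 + t (A *m w k) u * (eps *: (A *m v)) k 0)))
      => [|k _]; last first.
    have cE (c : R) (z : 'cV[R]_m) : (c *: z) k 0 = c * z k 0 by rewrite mxE.
    have dE (z z' : 'cV[R]_m) : (z + z') k 0 = z k 0 + z' k 0 by rewrite mxE.
    by rewrite !dE !cE; ring.
  (* The diagonal term gives [m%:R * t u v]. Each of [S3], [S4], [S5], [S6] reduces to
     [t v u = - t u v], whence the factor [m - 4]. *)
  rewrite !big_split/= S1 S2 S3 S4 S5 S6 (ta u v) => h.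
  have : (m%:R - 4) * t u v = 0.
    by move: h; rewrite !mulrA eps1 => h; rewrite -[RHS]h; ring.
  move/eqP; rewrite mulf_eq0 subr_eq0 eqr_nat => /orP[/eqP m4'|/eqP//].
  by rewrite m4' ltnn in m4.
have KB0 u v : B *m K u v = 0.
  apply: (scalerI mn0); rewrite tE !t00 mulr0 scale0r addr0 scaler0.
  by apply/matrixP => i j; rewrite !mxE mul0rn.
move=> u v; apply: (scalerI dl0).
by rewrite scaler0 -mul_scalar_mx -BB -mulmxA KB0 mulmx0.
Qed.

(** * Algebra of a paraquaternionic triple *)

Ltac entrywise :=
  let i := fresh "i" in let j := fresh "j" in
  apply/matrixP => i j; rewrite !mxE; try case: (i == j);
  rewrite ?mulr1n ?mulr0n.

(** The multiplication table follows from associativity and the five relations. The scalar part is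
    the Lorentz product and the rest is the cross product of P. *)
Lemma pq_mul (R : realType) m (J1 J2 J3 : 'M[R]_m) (a b c a' b' c' : R) :
  pq_triple J1 J2 J3 ->
  (a *: J1 + b *: J2 + c *: J3) *m (a' *: J1 + b' *: J2 + c' *: J3) =
  (a * a' + b * b' - c * c')%:M
  + ((c * b' - b * c') *: J1 + (a * c' - c * a') *: J2
     + (a * b' - b * a') *: J3).
Proof.
case=> J11 J22 J33 J12 J21.
have J32 : J3 *m J2 = J1 by rewrite -J12 -mulmxA J22 mulmx1.
have J13 : J1 *m J3 = J2 by rewrite -J12 mulmxA J11 mul1mx.
have J23 : J2 *m J3 = - J1 by rewrite -J12 mulmxA J21 mulNmx J32.
have J31 : J3 *m J1 = - J2 by rewrite -J12 -mulmxA J21 mulmxN J13.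
rewrite !mulmxDl !mulmxDr -!scalemxAl -!scalemxAr.
rewrite J11 J22 J33 J12 J21 J13 J23 J31 J32.
by entrywise; ring.
Qed.

Lemma scalar_mx_inj0 (R : realType) m (a : R) :
  (0 < m)%N -> (a%:M : 'M[R]_m) = 0 -> a = 0.
Proof.
move=> m0 h; have := congr1 (fun X : 'M[R]_m => X (Ordinal m0) (Ordinal m0)) h.
by rewrite !mxE eqxx mulr1n.
Qed.

Lemma pq_square (R : realType) m (J1 J2 J3 : 'M[R]_m) (x y z : R) :
  pq_triple J1 J2 J3 ->
  (x *: J1 + y *: J2 + z *: J3) *m (x *: J1 + y *: J2 + z *: J3) =
  (x ^+ 2 + y ^+ 2 - z ^+ 2)%:M.
Proof.
by move=> /pq_mul ->; entrywise; ring.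
Qed.

(* The plane of elements of [P] anticommuting with [A] is a rank one module
   over [R[A]], generated by any invertible element [B] of it. *)
Lemma pq_orthogonal_generator (R : realType) m (J1 J2 J3 : 'M[R]_m)
    (x y z : R) :
  let A := x *: J1 + y *: J2 + z *: J3 in
  (0 < m)%N -> pq_triple J1 J2 J3 -> x ^+ 2 + y ^+ 2 - z ^+ 2 != 0 ->
  exists (B : 'M[R]_m) (dl : R),
    [/\ dl != 0, B *m B = dl%:M, A *m B = - (B *m A) &
     forall k1 k2 k3 : R, let K := k1 *: J1 + k2 *: J2 + k3 *: J3 in
       A *m K = - (K *m A) -> exists a b : R, B *m K = a%:M + b *: A].
Proof.
move=> A m0 pq q0.
(* The scalar part of [A *m K + K *m A] is twice the Lorentz product, so anticommutation forces
   orthogonality. *)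
have orth k1 k2 k3 : let K := k1 *: J1 + k2 *: J2 + k3 *: J3 in
    A *m K = - (K *m A) -> x * k1 + y * k2 = z * k3.
  move=> K /eqP; rewrite -addr_eq0 !pq_mul// => /eqP h.
  have : (2 * (x * k1 + y * k2 - z * k3))%:M = 0 :> 'M[R]_m.
    rewrite -h.
    by entrywise; ring.
  by move/(scalar_mx_inj0 m0); lra.
(* On the [J3] axis [J1] is orthogonal to [A]. Off it, [y J1 - x J2] is, and its square
   [x ^+ 2 + y ^+ 2] is nonzero. *)
have [xy0|xy0] := eqVneq (x ^+ 2 + y ^+ 2) 0.
- have x0 : x = 0 by nra.
  have y0 : y = 0 by nra.
  have z0 : z != 0 by apply: contraNneq q0 => ->; rewrite xy0 expr0n subrr.
  exists (1 *: J1 + 0 *: J2 + 0 *: J3), 1.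
  split; first exact: oner_neq0.
  + by rewrite pq_mul//; entrywise; ring.
  + by rewrite /A !pq_mul// x0 y0; entrywise; ring.
  + move=> k1 k2 k3 K /(orth k1 k2 k3); rewrite x0 y0 !mul0r add0r => /esym/eqP.
    rewrite mulf_eq0 (negPf z0)/= => /eqP k30; exists k1, (k2 / z).
    by rewrite pq_mul// /A x0 y0 k30; entrywise; field.
- exists (y *: J1 + - x *: J2 + 0 *: J3), (x ^+ 2 + y ^+ 2).
  split=> //.
  + by rewrite pq_mul//; entrywise; ring.
  + by rewrite /A !pq_mul//; entrywise; ring.
  + move=> k1 k2 k3 K /(orth k1 k2 k3) h; exists (k1 * y - k2 * x), k3.
    have {}h : x * k1 = z * k3 - y * k2 by rewrite -h addrK.
    by rewrite pq_mul//; entrywise; ring: h.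
Qed.

(** * Commutators and the twisted curvature *)

Definition mxcomm (R : realType) m (X Y : 'M[R]_m) : 'M[R]_m := X *m Y - Y *m X.

Ltac expand_mulmx :=
  rewrite /mxcomm ?(mulmxDl, mulmxDr, mulmxN, mulNmx, opprD, opprK,
                    =^~ scalemxAl, =^~ scalemxAr, =^~ mulmxA).

(* Once expanded products are opaque atoms, noncommutative identities reduce to
   commutative ones between matrix entries. *)
Ltac generalize_products :=
  repeat match goal with |- context [?X *m ?Y] =>
    let x := fresh "x" in move: (X *m Y) => x end.

(** The anticommutator of [A] with [mxcomm X A] is the commutator of [X] with [A *m A], which is
    scalar. *)
Lemma mxcomm_anticomm (R : realType) m (A X : 'M[R]_m) (eps : R) :
  A *m A = eps%:M -> A *m mxcomm X A = - (mxcomm X A *m A).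
Proof.
move=> AA; rewrite /mxcomm mulmxBr mulmxBl !mulmxA AA -(mulmxA X) AA.
by rewrite mul_scalar_mx mul_mx_scalar opprB.
Qed.

Section TwistedCurvature.
Variables (R : realType) (m : nat) (A : 'M[R]_m) (eps : R).
Variable Rm : 'cV[R]_m -> 'cV[R]_m -> 'M[R]_m.
Hypothesis AA : A *m A = eps%:M.
Hypothesis Rl : forall a u u' v, Rm (a *: u + u') v = a *: Rm u v + Rm u' v.
Hypothesis Ra : forall u v, Rm v u = - Rm u v.
Hypothesis bianchi : forall u v w, Rm u v *m w + Rm v w *m u + Rm w u *m v = 0.

Let S u v := mxcomm (Rm u v) A.
Definition twisted_curvature u v :=
  S (A *m u) (A *m v) - A *m S (A *m u) v - A *m S u (A *m v) + eps *: S u v.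
Let K := twisted_curvature.

Let AAc (n : nat) (X : 'M[R]_(m, n)) : A *m (A *m X) = eps *: X.
Proof. by rewrite mulmxA AA mul_scalar_mx. Qed.

Let Sl a u u' v : S (a *: u + u') v = a *: S u v + S u' v.
Proof.
by rewrite /S Rl; expand_mulmx; generalize_products; entrywise; ring.
Qed.

Let Sa u v : S v u = - S u v.
Proof. by rewrite /S Ra; expand_mulmx. Qed.

Lemma twisted_curvature_linear a u u' v :
  K (a *: u + u') v = a *: K u v + K u' v.
Proof.
rewrite /K /twisted_curvature mulmxDr -scalemxAr !Sl /S; expand_mulmx.
by generalize_products; entrywise; ring.
Qed.

Lemma twisted_curvature_anti u v : K v u = - K u v.
Proof.
rewrite /K /twisted_curvature (Sa u v) (Sa (A *m u)) (Sa u) (Sa (A *m u) v) /S.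
by expand_mulmx; generalize_products; entrywise; ring.
Qed.

(** Expanded, the sum is a combination of Bianchi sums with [A] applied to some of the three
    vectors, so each piece vanishes. *)
Lemma twisted_curvature_cyclic u v w : K u v *m w + K v w *m u + K w u *m v = 0.
Proof.
pose b u v w := Rm u v *m w + Rm v w *m u + Rm w u *m v.
have -> : K u v *m w + K v w *m u + K w u *m v =
    b (A *m u) (A *m v) (A *m w)
  - A *m (b (A *m u) (A *m v) w + b (A *m u) v (A *m w) + b u (A *m v) (A *m w))
  + eps *: (b (A *m u) v w + b u (A *m v) w + b u v (A *m w))
  - eps *: (A *m b u v w).
  rewrite /K /twisted_curvature /S /b; expand_mulmx; rewrite !AAc.
  by generalize_products; entrywise; ring.
by rewrite /b !bianchi !addr0 mulmx0 !scaler0 !subr0 addr0.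
Qed.

(** As [A *m A] is scalar, replacing [u] by [A *m u] permutes the four terms up to left
    multiplication by [- A], and [K u v] anticommutes with [A]. *)
Lemma twisted_curvature_mulmx u v : K (A *m u) v = K u v *m A.
Proof.
have RZ a u' v' : Rm (a *: u') v' = a *: Rm u' v'.
  have R0 : Rm 0 v' = 0.
    have := Rl 1 0 0 v'; rewrite !scale1r addr0 => h.
    by apply: (addrI (Rm 0 v')); rewrite addr0 -h.
  by rewrite -[_ *: u']addr0 Rl R0 addr0.
rewrite /K /twisted_curvature /S AAc !RZ; expand_mulmx.
rewrite !AAc ?AA !mul_mx_scalar -?scalemxAr.
by generalize_products; entrywise; ring.
Qed.

Lemma twisted_curvature_eq0 (B : 'M[R]_m) (dl : R) :
  (4 < m)%N -> eps * eps = 1 -> dl != 0 -> B *m B = dl%:M ->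
  A *m B = - (B *m A) ->
  (forall u v, exists a b, B *m mxcomm (Rm u v) A = a%:M + b *: A) ->
  forall u v, twisted_curvature u v = 0.
Proof.
move=> m4 eps1 dl0 BB AB BS.
apply: (cyclic_form_eq0 m4 eps1 dl0 AA BB AB).
- exact: twisted_curvature_linear.
- exact: twisted_curvature_anti.
- exact: twisted_curvature_mulmx.
- move=> u v.
  have [a1 [b1 E1]] := BS (A *m u) (A *m v).
  have [a2 [b2 E2]] := BS (A *m u) v.
  have [a3 [b3 E3]] := BS u (A *m v).
  have [a4 [b4 E4]] := BS u v.
  have BA X : B *m (A *m X) = - (A *m (B *m X)).
    by rewrite !mulmxA AB mulNmx opprK.
  (* Moving [B] past the left factor [A] costs a sign. Multiplying [a + b A] by [A] then exchanges
     the coefficients, with a factor [eps] on [b]. *)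
  exists (a1 + b2 * eps + b3 * eps + eps * a4), (b1 + a2 + a3 + eps * b4).
  rewrite /twisted_curvature /S.
  move: (mxcomm (Rm (A *m u) (A *m v)) A) E1 => S1 E1.
  move: (mxcomm (Rm (A *m u) v) A) E2 => S2 E2.
  move: (mxcomm (Rm u (A *m v)) A) E3 => S3 E3.
  move: (mxcomm (Rm u v) A) E4 => S4 E4.
  rewrite !mulmxDr !mulmxN -scalemxAr !BA !opprK.
  rewrite E1 E2 E3 E4 !mulmxDr -!scalemxAr AA !mul_mx_scalar.
  by entrywise; ring.
- exact: twisted_curvature_cyclic.
Qed.

End TwistedCurvature.

(** * First-order variation of the bundle structure at one point *)

Section StructureTorsion.
Variables (R : realType) (m : nat) (A : 'M[R]_m).
Variable g : 'cV[R]_m -> 'M[R]_m.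
Variable d : 'cV[R]_m -> 'cV[R]_m -> 'M[R]_m.
Hypothesis gl : forall a u v, g (a *: u + v) = a *: g u + g v.
Hypothesis gs : forall u v, g u *m v = g v *m u.

Definition curvature u v := d u v - d v u + mxcomm (g u) (g v).

(* [bundle_struct G (x, A)], for [g := conn_form G x]. *)
Definition frozen_struct (w : endo_coord R m) : endo_coord R m :=
  (A *m w.1, A *m (w.2 + mxcomm (g w.1) A) - mxcomm (g (A *m w.1)) A).

(* The derivative along [w] of [fun s => bundle_struct G s p] at [(x, A)], for
   [d u v] the derivative along [u] of [fun y => conn_form G y v] at [x]. *)
Definition struct_deriv (w p : endo_coord R m) : endo_coord R m :=
  (w.2 *m p.1,
   w.2 *m (p.2 + mxcomm (g p.1) A)
   + A *m (mxcomm (d w.1 p.1) A + mxcomm (g p.1) w.2)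
   - (mxcomm (d w.1 (A *m p.1)) A + mxcomm (g (w.2 *m p.1)) A
      + mxcomm (g (A *m p.1)) w.2)).

Let F := frozen_struct.
Let dF := struct_deriv.

(** This is the base component of the Nijenhuis bracket. It vanishes because [g] is symmetric, that
    is, because the torsion is zero. *)
Lemma struct_deriv_fst (w p : endo_coord R m) :
  (F w).2 *m p.1 - (F p).2 *m w.1 + A *m (p.2 *m w.1) - A *m (w.2 *m p.1) = 0.
Proof.
case: w p => u C [v B] /=.
have E1 : g u *m (A *m v) = g (A *m v) *m u by rewrite gs.
have E2 : g v *m (A *m u) = g (A *m u) *m v by rewrite gs.
have E3 : g u *m v = g v *m u by rewrite gs.
expand_mulmx; rewrite E1 E2 E3.
have E4 : g (A *m u) *m (A *m v) = g (A *m v) *m (A *m u) by rewrite gs.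
by rewrite E4; generalize_products; entrywise; ring.
Qed.

Lemma struct_deriv_alternation (w p : endo_coord R m) (eps : R) :
  A *m A = eps%:M ->
  dF (F w) p - dF (F p) w + F (dF p w) - F (dF w p) =
  (0, - twisted_curvature A eps curvature w.1 p.1).
Proof.
move=> AA.
have gB u v : g (u - v) = g u - g v.
  by rewrite addrC -scaleN1r gl scaleN1r addrC.
have gD u v : g (u + v) = g u + g v by rewrite -[u]scale1r gl !scale1r.
(* Passed through the linear [g], the base identity cancels every value of [g] at an endomorphism
   component applied to a vector. Only curvature terms survive. *)
have gE : g ((F w).2 *m p.1) =
    g ((F p).2 *m w.1) - g (A *m (p.2 *m w.1)) + g (A *m (w.2 *m p.1)).
  rewrite -gB -gD; congr g.
  rewrite -[LHS]subr0 -(struct_deriv_fst w p).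
  by generalize_products; entrywise; ring.
apply/eqP; rewrite xpair_eqE /=; apply/andP; split; apply/eqP.
  exact: struct_deriv_fst.
rewrite gE; case: w p {gE} => u C [v B] /=.
rewrite /twisted_curvature /curvature.
have AAc n (X : 'M[R]_(m, n)) : A *m (A *m X) = eps *: X.
  by rewrite mulmxA AA mul_scalar_mx.
rewrite ?AAc.
repeat match goal with
  | |- context [g ?X] => let x := fresh "x" in move: (g X) => x
  | |- context [d ?X ?Y] => let x := fresh "x" in move: (d X Y) => x
  end.
expand_mulmx; rewrite ?AAc.
by generalize_products; entrywise; ring.
Qed.

End StructureTorsion.

(** * Symmetry of second derivatives *)

Lemma is_derive_line (R : realType) (V W : normedModType R) (f : V -> W)
    (y u : V) (s : R) (l : W) :
  is_derive (s *: u + y) u f l -> is_derive s 1 (fun r => f (r *: u + y)) l.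
Proof.
case=> df fl.
have E :
    (fun h : R =>
       h^-1 *: (f ((h *: (1 : R) + s) *: u + y) - f (s *: u + y))) =
    (fun h : R => h^-1 *: (f (h *: u + (s *: u + y)) - f (s *: u + y))).
  by apply/funext => h; rewrite scalerDl /GRing.scale/= mulr1 addrA.
by apply: DeriveDef; rewrite /derivable /derive/= E.
Qed.

(** The mean value theorem is used twice: along [u] for the difference of [f] on two opposite sides
    of the square, then along [v] for [fu]. *)
Lemma mixed_mean_value (R : realType) (V : normedModType R) (U : set V)
    (f fu fuv : V -> R) (x u v : V) (h : R) :
  0 < h ->
  (forall s t, 0 <= s <= h -> 0 <= t <= h -> U (s *: u + (t *: v + x))) ->
  (forall y, U y -> is_derive y u f (fu y)) ->
  (forall y, U y -> is_derive y v fu (fuv y)) ->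
  exists s t, [/\ 0 <= s <= h, 0 <= t <= h &
    f (h *: u + (h *: v + x)) - f (h *: u + x) - (f (h *: v + x) - f x) =
    fuv (s *: u + (t *: v + x)) * h * h].
Proof.
move=> h0 hU Df Dfu.
have hh : 0 <= h <= h by rewrite lexx ltW.
have zh : 0 <= (0 : R) <= h by rewrite lexx ltW.
pose p s := f (s *: u + (h *: v + x)) - f (s *: u + x).
pose dp s := fu (s *: u + (h *: v + x)) - fu (s *: u + x).
have Dp s : 0 <= s <= h -> is_derive s 1 p (dp s).
  move=> sh; apply: is_deriveB.
    by apply: is_derive_line; apply: Df; exact: hU.
  apply: is_derive_line; apply: Df.
  by have := hU s 0 sh zh; rewrite scale0r add0r.
have [s] : exists2 s, s \in `]0, h[%R & p h - p 0 = dp s * (h - 0).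
  apply: MVT => [//|s|].
    by rewrite in_itv/= => /andP[s0 sh]; apply: Dp; rewrite !ltW.
  by apply: derivable_within_continuous => s; rewrite in_itv/= => /Dp[].
rewrite in_itv/= => /andP[s0 sh]; have {s0 sh}sh : 0 <= s <= h by rewrite !ltW.
rewrite /p /dp scale0r !add0r subr0 => pE.
pose q t := fu (t *: v + (s *: u + x)).
have Dq t : 0 <= t <= h -> is_derive t 1 q (fuv (t *: v + (s *: u + x))).
  by move=> th; apply: is_derive_line; apply: Dfu; rewrite addrCA; exact: hU.
have [t] : exists2 t, t \in `]0, h[%R &
    q h - q 0 = fuv (t *: v + (s *: u + x)) * (h - 0).
  apply: MVT => [//|t|].
    by rewrite in_itv/= => /andP[t0 th]; apply: Dq; rewrite !ltW.
  by apply: derivable_within_continuous => t; rewrite in_itv/= => /Dq[].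
rewrite in_itv/= => /andP[t0 th]; have {t0 th}th : 0 <= t <= h by rewrite !ltW.
rewrite /q scale0r !add0r subr0 => qE.
by exists s, t; split=> //; rewrite pE addrCA qE addrCA.
Qed.

(** Schwarz's theorem. The second difference over a square is symmetric in [u] and [v], so [fuv] and
    [fvu] share a value at two points of any small square at [x], and continuity carries this to
    [x]. *)
Lemma is_derive_symmetric (R : realType) (V : normedModType R) (U : set V)
    (f fu fv fuv fvu : V -> R) (x u v : V) :
  open U -> U x ->
  (forall y, U y -> is_derive y u f (fu y)) ->
  (forall y, U y -> is_derive y v f (fv y)) ->
  (forall y, U y -> is_derive y v fu (fuv y)) ->
  (forall y, U y -> is_derive y u fv (fvu y)) ->
  {for x, continuous fuv} -> {for x, continuous fvu} -> fuv x = fvu x.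
Proof.
move=> oU Ux Du Dv Duv Dvu cuv cvu.
apply/eqP; rewrite -subr_eq0 -normr_le0; apply/ler_addgt0Pl => e e0.
rewrite addr0.
have e20 : 0 < e / 2 by rewrite divr_gt0.
have /nbhs_ballP[r r0 rP] : nbhs x [set y | [/\ U y,
    `|fuv x - fuv y| <= e / 2 & `|fvu x - fvu y| <= e / 2]].
  near=> y; split; near: y.
  - exact: open_nbhs_nbhs.
  - by move/cvgrPdist_le : cuv => /(_ _ e20).
  - by move/cvgrPdist_le : cvu => /(_ _ e20).
(* The summand 1 keeps [c] positive even for [u = v = 0]. With [h * c = r / 2] the whole square
   stays in the ball. *)
pose c := `|u| + `|v| + 1; have c0 : 0 < c by rewrite ltr_pwDr// addr_ge0.
pose h := r / 2 / c; have h0 : 0 < h by rewrite !divr_gt0.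
have hball s t : 0 <= s <= h -> 0 <= t <= h -> ball x r (s *: u + (t *: v + x)).
  move=> /andP[s0 sh] /andP[t0 th].
  rewrite -ball_normE/= addrA opprD addrCA subrr addr0 normrN.
  rewrite (le_lt_trans (ler_normD _ _))// !normrZ !ger0_norm//.
  apply: (@le_lt_trans _ _ (h * c)).
    by rewrite !mulrDr mulr1 -[leLHS]addr0 !lerD// ?ler_wpM2r// ltW.
  by rewrite divfK ?gt_eqF// ltr_pdivrMr// ltr_pMr// ltr1n.
have hU s t : 0 <= s <= h -> 0 <= t <= h -> U (s *: u + (t *: v + x)).
  by move=> sh th; have [] := rP _ (hball s t sh th).
have hU' t s : 0 <= t <= h -> 0 <= s <= h -> U (t *: v + (s *: u + x)).
  by move=> th sh; rewrite addrCA; exact: hU.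
have [s [t [sh th E]]] := mixed_mean_value h0 hU Du Duv.
have [t' [s' [th' sh' E']]] := mixed_mean_value h0 hU' Dv Dvu.
have {E'}E : fuv (s *: u + (t *: v + x)) = fvu (t' *: v + (s' *: u + x)).
  apply: (mulIf (lt0r_neq0 h0)); apply: (mulIf (lt0r_neq0 h0)).
  rewrite -E -E' [h *: v + (_ + _)]addrCA; ring.
have [_ b1 _] := rP _ (hball s t sh th).
have [_ _] := rP _ (hball s' t' sh' th'); rewrite addrCA -E => b2.
rewrite (splitr e) -(subrKA (fuv (s *: u + (t *: v + x)))).
by rewrite (le_trans (ler_normD _ _))// lerD// distrC.
Unshelve. all: by end_near. Qed.

(** * Calculus of matrix-valued functions *)

Section MatrixCalculus.
Variables (R : realType) (V : normedModType R).

Lemma is_derive_mxP m n (M : V -> 'M[R]_(m, n)) (x v : V) (dM : 'M[R]_(m, n)) :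
  is_derive x v M dM <->
  forall i j, is_derive x v (fun y => M y i j) (dM i j).
Proof.
split=> [[dM1 <-] i j|DM].
  apply: DeriveDef; first by move/derivable_mxP: (dM1); exact.
  by rewrite derive_mx// mxE.
have dM1 : derivable M x v by apply/derivable_mxP => i j; case: (DM i j).
apply: DeriveDef => //; rewrite derive_mx//; apply/matrixP => i j.
by rewrite mxE; case: (DM i j).
Qed.

Lemma differentiable_mxP m n (M : V -> 'M[R]_(m, n)) (x : V) :
  differentiable M x <-> forall i j, differentiable (fun y => M y i j) x.
Proof.
split=> [dM i j|dM].
  apply: (@differentiable_comp _ _ _ _ M (fun N : 'M[R]_(m, n) => N i j)) => //.
  exact: differentiable_coord.
have -> : M = \sum_i \sum_j (fun y => M y i j *: delta_mx i j).
  apply/funext => y; rewrite fct_sumE [LHS]matrix_sum_delta.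
  by apply: eq_bigr => i _; rewrite fct_sumE.
apply: differentiable_sum => i; apply: differentiable_sum => j.
exact: differentiableZl.
Qed.

Lemma is_derive_sum_fun n (h : 'I_n -> V -> R) (x v : V) (dh : 'I_n -> R) :
  (forall i, is_derive x v (h i) (dh i)) ->
  is_derive x v (fun y => \sum_i h i y) (\sum_i dh i).
Proof.
move=> Dh; have -> : (fun y => \sum_i h i y) = \sum_i h i.
  by apply/funext => y; rewrite fct_sumE.
exact: is_derive_sum.
Qed.

Lemma is_derive_mul_fun (f g : V -> R) (x v : V) (df dg : R) :
  is_derive x v f df -> is_derive x v g dg ->
  is_derive x v (fun y => f y * g y) (df * g x + f x * dg).
Proof.
move=> Df Dg; apply: is_derive_eq (is_deriveM Df Dg) _.
by rewrite addrC mulrC.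
Qed.

Lemma is_derive_mulmx m n p (M : V -> 'M[R]_(m, n)) (N : V -> 'M[R]_(n, p))
    (x v : V) (dM : 'M[R]_(m, n)) (dN : 'M[R]_(n, p)) :
  is_derive x v M dM -> is_derive x v N dN ->
  is_derive x v (fun y => M y *m N y) (dM *m N x + M x *m dN).
Proof.
move=> /is_derive_mxP DM /is_derive_mxP DN; apply/is_derive_mxP => i j.
rewrite !mxE -big_split/=; under eq_fun do rewrite mxE.
by apply: is_derive_sum_fun => k; exact: is_derive_mul_fun.
Qed.

Lemma differentiable_mulmx m n p (M : V -> 'M[R]_(m, n)) (N : V -> 'M[R]_(n, p))
    (x : V) :
  differentiable M x -> differentiable N x ->
  differentiable (fun y => M y *m N y) x.
Proof.
move=> /differentiable_mxP dM /differentiable_mxP dN; apply/differentiable_mxP.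
move=> i j; under eq_fun do rewrite mxE.
have -> : (fun y => \sum_k M y i k * N y k j) =
    \sum_k (fun y => M y i k) * (fun y => N y k j).
  by apply/funext => y; rewrite fct_sumE.
by apply: differentiable_sum => k; exact: differentiableM.
Qed.

End MatrixCalculus.

(** * Closure properties of smooth functions on an open set *)

Section SmoothFunctions.
Variables (R : realType) (V : normedModType R) (U : set V).
Hypothesis oU : open U.
Implicit Types W : normedModType R.

Lemma eq_near_open W (f g : V -> W) x :
  U x -> (forall y, U y -> f y = g y) -> \near x, f x = g x.
Proof. by move=> Ux fg; near=> y; apply: fg; near: y; exact: open_nbhs_nbhs.
Unshelve. all: by end_near. Qed.

(** The first-order expansion of [f] at [x] is also one for [g], and uniqueness of the differential
    identifies ['d g x] with ['d f x]. *)
Lemma eq_differentiable W (f g : V -> W) x :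
  U x -> (forall y, U y -> f y = g y) ->
  differentiable f x -> differentiable g x.
Proof.
move=> Ux fg df; have nfg := eq_near_open Ux fg.
have E : g \o shift x = cst (g x) + 'd f x +o_ (0 : V) id.
  apply/eqaddoP => e e0.
  have /eqaddoP /(_ _ e0) H := diff_locally df.
  have nfg0 : \forall h \near (0 : V), f (h + x) = g (h + x).
    move: nfg; rewrite (near_shift 0); apply: filterS => h /=.
    by rewrite subr0.
  near=> h.
  have -> : (g \o shift x - (cst (g x) + 'd f x)) h =
            (f \o shift x - (cst (f x) + 'd f x)) h.
    rewrite -!(fg x Ux) /=; congr (_ - _).
    by rewrite /= (near nfg0 h).
  by near: h.
have dgE : 'd g x = 'd f x :> (V -> W).
  by apply: diff_unique E; exact: diff_continuous.
by apply/diff_locallyP; rewrite dgE; split => //; exact: diff_continuous.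
Unshelve. all: by end_near. Qed.

Lemma eq_Ck W k (f g : V -> W) :
  (forall y, U y -> f y = g y) -> Ck k U f -> Ck k U g.
Proof.
elim: k f g => [|k IH] f g fg /=.
  move=> cf x Ux; have fx : f z @[z --> x] --> g x.
    by rewrite -(fg _ Ux); exact: cf.
  by apply: cvg_trans fx; apply: near_eq_cvg; exact: eq_near_open.
move=> [df Cf]; split=> [x Ux|v]; first exact: eq_differentiable (df _ Ux).
apply: IH (Cf v) => y Uy; apply: near_eq_derive; exact: eq_near_open.
Qed.

Lemma Ck_linear W k (a : R) (f g : V -> W) :
  Ck k U f -> Ck k U g -> Ck k U (fun y => a *: f y + g y).
Proof.
elim: k f g => [|k IH] f g /=.
  move=> cf cg x Ux; apply: cvgD; last exact: cg.
  apply: cvgZl_tmp; exact: cf.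
move=> [df Cf] [dg Cg]; split=> [x Ux|v].
  apply: (@differentiableD _ _ _ (a *: f) g); last exact: dg.
  by apply: differentiableZ; exact: df.
apply: eq_Ck (IH _ _ (Cf v) (Cg v)) => y Uy; apply/esym.
have Df : derivable f y v by apply: diff_derivable; exact: df.
have Dg : derivable g y v by apply: diff_derivable; exact: dg.
by rewrite (@deriveD _ _ _ (a *: f) g) ?deriveZ//; exact: derivableZ.
Qed.

Lemma smooth_linear W (a : R) (f g : V -> W) :
  smooth U f -> smooth U g -> smooth U (fun y => a *: f y + g y).
Proof. by move=> Sf Sg k; exact: Ck_linear. Qed.

Lemma smooth_cst W (c : W) : smooth U (fun=> c).
Proof.
move=> k; elim: k c => [|k IH] c /=; first by move=> x _; exact: cvg_cst.
split=> [x _|v]; first exact: differentiable_cst.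
by apply: eq_Ck (IH 0) => y _; rewrite derive_cst.
Qed.

Lemma smooth_sub W (f g : V -> W) :
  smooth U f -> smooth U g -> smooth U (fun y => f y - g y).
Proof.
move=> Sf Sg k; apply: eq_Ck (Ck_linear (-1) (Sg k) (Sf k)) => y _.
by rewrite scaleN1r addrC.
Qed.

Lemma smooth_add W (f g : V -> W) :
  smooth U f -> smooth U g -> smooth U (fun y => f y + g y).
Proof.
move=> Sf Sg k; apply: eq_Ck (Ck_linear 1 (Sf k) (Sg k)) => y _.
by rewrite scale1r.
Qed.

Lemma smooth_linear_comb W n (c : 'I_n -> R) (f : 'I_n -> V -> W) :
  (forall i, smooth U (f i)) -> smooth U (fun y => \sum_i c i *: f i y).
Proof.
move=> Sf; elim: (index_enum _) => [|i r IH] k.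
  by apply: eq_Ck (smooth_cst 0 k) => y _; rewrite big_nil.
by apply: eq_Ck (smooth_linear (c i) (Sf i) IH k) => y _; rewrite big_cons.
Qed.

Lemma smooth_derive W (f : V -> W) v :
  smooth U f -> smooth U (fun y => 'D_v f y).
Proof. by move=> Sf k; have [_ Cf] := Sf k.+1; exact: Cf. Qed.

Lemma smooth_differentiable W (f : V -> W) x :
  smooth U f -> U x -> differentiable f x.
Proof. by move=> Sf Ux; have [df _] := Sf 1%N; exact: df. Qed.

Lemma smooth_is_derive W (f : V -> W) x v :
  smooth U f -> U x -> is_derive x v f ('D_v f x).
Proof.
by move=> Sf Ux; apply/derivableP/diff_derivable/smooth_differentiable.
Qed.

Lemma smooth_mulmx m n p (M : V -> 'M[R]_(m, n)) (N : V -> 'M[R]_(n, p)) :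
  smooth U M -> smooth U N -> smooth U (fun y => M y *m N y).
Proof.
(* Both factors stay smooth to all orders in the induction, so the two Leibniz terms are again
   instances of the induction hypothesis. *)
move=> SM SN k; elim: k M N SM SN => [|k IH] M N SM SN /=.
  move=> x Ux; apply: differentiable_continuous.
  by apply: differentiable_mulmx; exact: smooth_differentiable.
split=> [x Ux|v].
  by apply: differentiable_mulmx; exact: smooth_differentiable.
have := Ck_linear 1 (IH _ _ (smooth_derive v SM) SN)
  (IH _ _ SM (smooth_derive v SN)).
apply: eq_Ck => y Uy; rewrite scale1r.
have [_ ->//] := is_derive_mulmx (smooth_is_derive v SM Uy)
  (smooth_is_derive v SN Uy).
Qed.

Lemma derive_symmetric m n (M : V -> 'M[R]_(m, n)) x u v :
  smooth U M -> U x ->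
  'D_v (fun y => 'D_u M y) x = 'D_u (fun y => 'D_v M y) x.
Proof.
move=> SM Ux; apply/matrixP => i j.
have SuM := smooth_derive u SM; have SvM := smooth_derive v SM.
have ent (N : V -> 'M[R]_(m, n)) w y :
    smooth U N -> U y -> is_derive y w (fun z => N z i j) ('D_w N y i j).
  by move=> SN Uy; have /is_derive_mxP := smooth_is_derive w SN Uy; exact.
have cont (N : V -> 'M[R]_(m, n)) :
    smooth U N -> {for x, continuous (fun z => N z i j)}.
  move=> SN; apply: differentiable_continuous.
  by move/differentiable_mxP : (smooth_differentiable SN Ux); exact.
apply: (@is_derive_symmetric _ _ U (fun y => M y i j)
  (fun y => 'D_u M y i j) (fun y => 'D_v M y i j)
  (fun y => 'D_v (fun z => 'D_u M z) y i j)
  (fun y => 'D_u (fun z => 'D_v M z) y i j) x u v oU Ux).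
- exact: (fun y => ent M u y SM).
- exact: (fun y => ent M v y SM).
- exact: (fun y => ent _ v y SuM).
- exact: (fun y => ent _ u y SvM).
- exact: (cont _ (smooth_derive v SuM)).
- exact: (cont _ (smooth_derive u SvM)).
Qed.

End SmoothFunctions.

Lemma Ck_subset (R : realType) (V W : normedModType R) k (U U' : set V)
    (f : V -> W) :
  U' `<=` U -> Ck k U f -> Ck k U' f.
Proof.
move=> UU; elim: k f => [|k IH] f /= Cf; first by move=> x /UU; exact: Cf.
by split=> [x /UU|v]; [exact: Cf.1|exact/IH/Cf.2].
Qed.

Lemma is_deriveP (R : realType) (V W : normedModType R) (f : V -> W) (x v : V)
    (l : W) :
  is_derive x v f l <-> h^-1 *: (f (h *: v + x) - f x) @[h --> 0^'] --> l.
Proof.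
split=> [[Df <-]|Df]; first exact: Df.
by apply: DeriveDef; [apply/cvg_ex; exists l|exact: cvg_lim Df].
Qed.

(** * Derivatives of maps into and out of products *)

Section PairCalculus.
Variables (R : realType) (V W1 W2 : normedModType R).
Let W : normedModType R := (W1 * W2)%type.

Lemma is_derive_pair (f : V -> W1) (g : V -> W2) (x v : V) (df : W1) (dg : W2) :
  is_derive x v f df -> is_derive x v g dg ->
  is_derive x v ((fun y => (f y, g y)) : V -> W) (df, dg).
Proof.
move=> /is_deriveP Df /is_deriveP Dg; apply/is_deriveP.
exact: cvg_pair Df Dg.
Qed.

Lemma is_derive_fst (f : V -> W) (x v : V) (df : W) :
  is_derive x v f df -> is_derive x v (fun y => (f y).1) df.1.
Proof.
move=> /is_deriveP Df; apply/is_deriveP.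
exact: (cvg_comp _ (fst : W -> W1) Df cvg_fst).
Qed.

Lemma is_derive_snd (f : V -> W) (x v : V) (df : W) :
  is_derive x v f df -> is_derive x v (fun y => (f y).2) df.2.
Proof.
move=> /is_deriveP Df; apply/is_deriveP.
exact: (cvg_comp _ (snd : W -> W2) Df cvg_snd).
Qed.

Lemma is_derive_comp_fst (f : W1 -> V) (x v : W) (df : V) :
  is_derive x.1 v.1 f df -> is_derive x v (fun y : W => f y.1) df.
Proof. by move=> /is_deriveP Df; apply/is_deriveP. Qed.

End PairCalculus.

(** * Differentiation of the connection form and of the bundle structure *)

Definition conn_form_deriv (R : realType) m (G : 'cV[R]_m -> 'I_m -> 'M[R]_m)
    (x u : 'cV[R]_m) : 'cV[R]_m -> 'M[R]_m :=
  conn_form (fun y a => 'D_u (G^~ a) y) x.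

Lemma conn_form_linear (R : realType) m (G : 'cV[R]_m -> 'I_m -> 'M[R]_m)
    (x : 'cV[R]_m) a u v :
  conn_form G x (a *: u + v) = a *: conn_form G x u + conn_form G x v.
Proof.
rewrite /conn_form scaler_sumr -big_split/=; apply: eq_bigr => k _.
by rewrite !mxE scalerDl scalerA.
Qed.

(** The base point runs through [q], so that the rule serves on a chart, with [q = id], and on the
    total space, with [q] the projection. The vector [u] stands for the velocity of [q]. *)
Lemma is_derive_conn_form (R : realType) m (G : 'cV[R]_m -> 'I_m -> 'M[R]_m)
    (V : normedModType R) (s w : V) (u : 'cV[R]_m)
    (q f : V -> 'cV[R]_m) (df : 'cV[R]_m) :
  (forall a, is_derive s w (fun y => G (q y) a) ('D_u (G^~ a) (q s))) ->
  is_derive s w f df ->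
  is_derive s w (fun y => conn_form G (q y) (f y))
    (conn_form_deriv G (q s) u (f s) + conn_form G (q s) df).
Proof.
move=> DG /is_derive_mxP Df; apply/is_derive_mxP => i j.
have E H (y z : 'cV[R]_m) : conn_form H y z i j = \sum_a z a 0 * H y a i j.
  by rewrite /conn_form summxE; apply: eq_bigr => a _; rewrite mxE.
rewrite mxE !E -big_split/=; under eq_fun do rewrite E.
apply: is_derive_sum_fun => a; rewrite addrC.
apply: is_derive_mul_fun.
by have /is_derive_mxP := DG a; exact.
Qed.

Lemma bundle_structE (R : realType) m (G : 'cV[R]_m -> 'I_m -> 'M[R]_m) s w :
  bundle_struct G s w = frozen_struct s.2 (conn_form G s.1) w.
Proof.
rewrite /bundle_struct /hlift /vpart /frozen_struct /mxcomm/=; congr (_, _).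
  by rewrite addr0.
by rewrite opprK addrC.
Qed.

(** The Leibniz rule separates the variation of the structure, [struct_deriv], from that of the
    field it acts on. *)
Lemma is_derive_bundle_struct (R : realType) m
    (G : 'cV[R]_m -> 'I_m -> 'M[R]_m) (X : endo_coord R m -> endo_coord R m)
    (s w : endo_coord R m) (dX : endo_coord R m) :
  (forall a, is_derive s.1 w.1 (G^~ a) ('D_(w.1) (G^~ a) s.1)) ->
  is_derive s w X dX ->
  is_derive s w (fun u => bundle_struct G u (X u))
    (struct_deriv s.2 (conn_form G s.1) (conn_form_deriv G s.1) w (X s)
     + bundle_struct G s dX).
Proof.
move=> DG DX; under eq_fun do rewrite bundle_structE.
rewrite bundle_structE.
have DX1 := is_derive_fst DX; have DX2 := is_derive_snd DX.
have DA : is_derive s w (fun u : endo_coord R m => u.2) w.2.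
  exact: is_derive_snd (is_derive_id _ _).
have Dg f df := @is_derive_conn_form _ _ G _ s w w.1
  (fun u : endo_coord R m => u.1) f df (fun a => is_derive_comp_fst (DG a)).
have DAX := is_derive_mulmx DA DX1.
have Dcomm f df : is_derive s w f df ->
   is_derive s w (fun u : endo_coord R m => mxcomm (conn_form G u.1 (f u)) u.2)
    (mxcomm (conn_form_deriv G s.1 w.1 (f s) + conn_form G s.1 df) s.2
     + mxcomm (conn_form G s.1 (f s)) w.2).
  move=> Df; have Dgf := Dg _ _ Df.
  apply: is_derive_eq
    (is_deriveB (is_derive_mulmx Dgf DA) (is_derive_mulmx DA Dgf)) _.
  by rewrite /mxcomm; generalize_products; entrywise; ring.
have DV := is_derive_mulmx DA (is_deriveD DX2 (Dcomm _ _ DX1)).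
have D := is_derive_pair DAX (is_deriveB DV (Dcomm _ _ DAX)).
apply: is_derive_eq D _.
rewrite /struct_deriv /frozen_struct; congr (_, _).
have gD u v : conn_form G s.1 (u + v) = conn_form G s.1 u + conn_form G s.1 v.
  by rewrite -[u]scale1r conn_form_linear !scale1r.
by rewrite gD /=; expand_mulmx; generalize_products; entrywise; ring.
Qed.

(** * Linearity and square of the structure at a point *)

Section FrozenStruct.
Variables (R : realType) (m : nat) (A : 'M[R]_m) (eps : R).
Variable g : 'cV[R]_m -> 'M[R]_m.
Hypothesis gl : forall a u v, g (a *: u + v) = a *: g u + g v.
Hypothesis AA : A *m A = eps%:M.

Lemma frozen_struct_linear a w p :
  frozen_struct A g (a *: w + p) =
  a *: frozen_struct A g w + frozen_struct A g p.
Proof.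
rewrite /frozen_struct/= mulmxDr -scalemxAr !gl; congr (_, _).
by expand_mulmx; generalize_products; entrywise; ring.
Qed.

Lemma frozen_struct_sub w p :
  frozen_struct A g (w - p) = frozen_struct A g w - frozen_struct A g p.
Proof. by rewrite addrC -scaleN1r frozen_struct_linear scaleN1r addrC. Qed.

Lemma frozen_struct_add w p :
  frozen_struct A g (w + p) = frozen_struct A g w + frozen_struct A g p.
Proof. by rewrite -[w in LHS]scale1r frozen_struct_linear scale1r. Qed.

(** In the splitting into horizontal and vertical parts the structure is left multiplication by [A]
    on each. *)
Lemma frozen_struct_square w :
  frozen_struct A g (frozen_struct A g w) = eps *: w.
Proof.
have AAc n (X : 'M[R]_(m, n)) : A *m (A *m X) = eps *: X.
  by rewrite mulmxA AA mul_scalar_mx.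
have gZ a u : g (a *: u) = a *: g u.
  have g0 : g 0 = 0.
    have := gl 1 0 0; rewrite !scale1r addr0 => h.
    by apply: (addrI (g 0)); rewrite addr0 -h.
  by rewrite -[a *: u]addr0 gl g0 addr0.
case: w => u C; rewrite /frozen_struct/= AAc gZ.
congr (_, _); expand_mulmx; rewrite !AAc.
by generalize_products; entrywise; ring.
Qed.

End FrozenStruct.

(** * Symmetries of the curvature *)

Section Bianchi.
Variables (R : realType) (m : nat).
Variable g : 'cV[R]_m -> 'M[R]_m.
Variable d : 'cV[R]_m -> 'cV[R]_m -> 'M[R]_m.

Lemma curvature_anti u v : curvature g d v u = - curvature g d u v.
Proof.
by rewrite /curvature; expand_mulmx; generalize_products; entrywise; ring.
Qed.

Lemma curvature_linear :
  (forall a u v, g (a *: u + v) = a *: g u + g v) ->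
  (forall a u u' v, d (a *: u + u') v = a *: d u v + d u' v) ->
  (forall a u v v', d u (a *: v + v') = a *: d u v + d u v') ->
  forall a u u' v, curvature g d (a *: u + u') v =
    a *: curvature g d u v + curvature g d u' v.
Proof.
move=> gl dl dr a u u' v; rewrite /curvature gl dl dr.
by expand_mulmx; generalize_products; entrywise; ring.
Qed.

(** The two symmetries express zero torsion and its first derivative. They make the terms of the
    cyclic sum cancel in pairs. *)
Lemma curvature_bianchi :
  (forall u v, g u *m v = g v *m u) ->
  (forall u v w, d u v *m w = d u w *m v) ->
  forall u v w, curvature g d u v *m w + curvature g d v w *m u
    + curvature g d w u *m v = 0.
Proof.
move=> gs ds u v w; rewrite /curvature; expand_mulmx.
rewrite (ds u w v) (ds v w u) (ds w v u) (gs v w) (gs u w) (gs u v).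
by generalize_products; entrywise; ring.
Qed.

End Bianchi.

(** Tensoriality: since [F s] squares to [eps], all derivatives of [X] and [Y] cancel, leaving only
    the variation of [F]. *)
Lemma nijenhuis_expand (R : realType) (V : normedModType R) (eps : R)
    (F dF : V -> V -> V) (X Y : V -> V) (s : V) :
  (forall w, 'D_w (fun u => F u (X u)) s = dF w (X s) + F s ('D_w X s)) ->
  (forall w, 'D_w (fun u => F u (Y u)) s = dF w (Y s) + F s ('D_w Y s)) ->
  (forall w p, F s (w + p) = F s w + F s p) ->
  (forall w p, F s (w - p) = F s w - F s p) ->
  (forall w, F s (F s w) = eps *: w) ->
  nijenhuis eps F X Y s =
  dF (F s (X s)) (Y s) - dF (F s (Y s)) (X s)
  + F s (dF (Y s) (X s)) - F s (dF (X s) (Y s)).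
Proof.
rewrite /nijenhuis /lie_bracket.
move: (fun u => F u (X u)) (fun u => F u (Y u)) => FX FY EX EY FD FB FF.
rewrite !EX !EY !(FB, FD, FF) scalerBr !(opprB, opprD) !addrA.
(* The four surviving terms come first, followed by four pairs of opposite terms. *)
rewrite (ACl (1*3*5*9*(2*7)*(4*8)*(6*12)*(10*11))) /=.
by rewrite !(subrr, addNr, addr0).
Qed.

Lemma nijenhuis_bundle_struct (R : realType) m
    (G : 'cV[R]_m -> 'I_m -> 'M[R]_m) (X Y : endo_coord R m -> endo_coord R m)
    (s : endo_coord R m) (eps : R) :
  (forall a u, derivable (G^~ a) s.1 u) ->
  (forall w, derivable X s w) -> (forall w, derivable Y s w) ->
  (forall u v, conn_form G s.1 u *m v = conn_form G s.1 v *m u) ->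
  s.2 *m s.2 = eps%:M ->
  nijenhuis eps (bundle_struct G) X Y s =
  (0, - twisted_curvature s.2 eps
          (curvature (conn_form G s.1) (conn_form_deriv G s.1))
          (X s).1 (Y s).1).
Proof.
move=> DG DX DY gs AA.
have gl := conn_form_linear G s.1.
have DF Z : (forall w, derivable Z s w) -> forall w,
    'D_w (fun u => bundle_struct G u (Z u)) s =
    struct_deriv s.2 (conn_form G s.1) (conn_form_deriv G s.1) w (Z s)
    + bundle_struct G s ('D_w Z s).
  move=> DZ w; have DGw a : is_derive s.1 w.1 (G^~ a) ('D_(w.1) (G^~ a) s.1).
    by apply: derivableP; exact: DG.
  by have [_ ->] := is_derive_bundle_struct DGw (derivableP (DZ w)).
rewrite (nijenhuis_expand (DF X DX) (DF Y DY)) => [|w p|w p|w].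
- by rewrite -struct_deriv_alternation// !bundle_structE.
- by rewrite !bundle_structE; exact: frozen_struct_add.
- by rewrite !bundle_structE; exact: frozen_struct_sub.
- by rewrite !bundle_structE; exact: frozen_struct_square.
Qed.

(** * The curvature of a smooth connection in a chart *)

Section SmoothConnection.
Variables (R : realType) (m : nat) (G : 'cV[R]_m -> 'I_m -> 'M[R]_m).
Variable U : set 'cV[R]_m.
Hypothesis oU : open U.
Hypothesis SG : forall a, smooth U (G^~ a).

Lemma conn_form_is_derive x u v :
  U x -> is_derive x u (fun y => conn_form G y v) (conn_form_deriv G x u v).
Proof.
move=> Ux; have := @is_derive_conn_form _ _ G _ x u u id (fun=> v) 0
  (fun a => smooth_is_derive u (SG a) Ux) (is_derive_cst _ _ _).
move=> D; apply: is_derive_eq D _.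
rewrite [conn_form G _ 0](_ : _ = 0) ?addr0//.
by rewrite /conn_form big1// => a _; rewrite mxE scale0r.
Qed.

Lemma smooth_conn_form v : smooth U (fun y => conn_form G y v).
Proof. exact: smooth_linear_comb. Qed.

(** Additivity in the direction comes from differentiability: the directional derivatives are values
    of one linear differential. *)
Lemma conn_form_deriv_linear_dir x a u u' v : U x ->
  conn_form_deriv G x (a *: u + u') v =
  a *: conn_form_deriv G x u v + conn_form_deriv G x u' v.
Proof.
move=> Ux.
have D w := esym (@derive_val _ _ _ _ _ _ _ (conn_form_is_derive w v Ux)).
have df := smooth_differentiable (smooth_conn_form v) Ux.
by rewrite !D !deriveE// linearP.
Qed.

Lemma conn_form_deriv_symmetric x u v w : U x ->
  (forall y, U y -> conn_form G y v *m w = conn_form G y w *m v) ->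
  conn_form_deriv G x u v *m w = conn_form_deriv G x u w *m v.
Proof.
move=> Ux gs.
have D v' (w' : 'cV[R]_m) : is_derive x u (fun y => conn_form G y v' *m w')
    (conn_form_deriv G x u v' *m w').
  apply: is_derive_eq
    (is_derive_mulmx (conn_form_is_derive u v' Ux) (is_derive_cst w' x u)) _.
  by rewrite mulmx0 addr0.
have [_ <-] := D v w; have [_ <-] := D w v.
by apply: near_eq_derive; exact: (eq_near_open oU Ux gs).
Qed.

Lemma cov_endoE v (S : 'cV[R]_m -> 'M[R]_m) x :
  cov_endo G v S x = 'D_v S x + mxcomm (conn_form G x v) (S x).
Proof. by []. Qed.

Lemma smooth_cov_endo v (S : 'cV[R]_m -> 'M[R]_m) (U' : set 'cV[R]_m) :
  open U' -> U' `<=` U -> smooth U' S -> smooth U' (cov_endo G v S).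
Proof.
move=> oU' UU SS; have Sg : smooth U' (fun y => conn_form G y v).
  by move=> k; apply: Ck_subset UU _; exact: smooth_conn_form.
apply: smooth_add => //; first exact: smooth_derive.
by apply: smooth_sub => //; exact: smooth_mulmx.
Qed.

(** The Ricci identity on End(TM). The directions [u] and [v] are constant, so there is no bracket
    term, and the second derivatives of [S] cancel by symmetry. *)
Lemma cov_endo_commutator u v (S : 'cV[R]_m -> 'M[R]_m) (U' : set 'cV[R]_m) x :
  open U' -> U' `<=` U -> smooth U' S -> U' x ->
  cov_endo G u (cov_endo G v S) x - cov_endo G v (cov_endo G u S) x =
  mxcomm (curvature (conn_form G x) (conn_form_deriv G x) u v) (S x).
Proof.
move=> oU' UU SS U'x; have Ux := UU _ U'x.
have D a b : 'D_a (cov_endo G b S) x = 'D_a (fun y => 'D_b S y) x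
    + (mxcomm (conn_form_deriv G x a b) (S x)
       + mxcomm (conn_form G x b) ('D_a S x)).
  have DS := smooth_is_derive a SS U'x.
  have DDS := smooth_is_derive a (smooth_derive b SS) U'x.
  have Dg := conn_form_is_derive a b Ux.
  have [_ ->] := is_deriveD DDS
    (is_deriveB (is_derive_mulmx Dg DS) (is_derive_mulmx DS Dg)).
  by congr (_ + _); rewrite /mxcomm; generalize_products; entrywise; ring.
rewrite !cov_endoE !D (derive_symmetric oU' u v SS U'x).
rewrite /curvature.
move: ('D_u (fun y => 'D_v S y) x) ('D_u S x) ('D_v S x) (S x).
move=> DuvS DuS DvS Sx.
move: (conn_form G x u) (conn_form G x v) => gu gv.
move: (conn_form_deriv G x u v) (conn_form_deriv G x v u) => duv dvu.
by expand_mulmx; generalize_products; entrywise; ring.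
Qed.

End SmoothConnection.

(** * Torsion-freeness and preservation of P by the curvature *)

Section ParaquaternionicCurvature.
Variables (R : realType) (m : nat) (M : topologicalType) (at_ : atlas R m M).
Variables (P : paraquaternionic_structure at_) (D : linear_connection at_).

(** Zero torsion is tested on constant fields, whose bracket and derivatives vanish. *)
Lemma conn_form_symmetric (i : chart at_) (x u v : 'cV[R]_m) :
  torsion_free D -> chart_image i x ->
  conn_form (christoffel D i) x u *m v = conn_form (christoffel D i) x v *m u.
Proof.
move=> Dtf cx; have oC : open (chart_image i) := @image_open _ _ _ at_ i.
have := Dtf i _ (fun=> u) (fun=> v) oC (fun _ h => h)
  (smooth_cst oC u) (smooth_cst oC v) x cx.
rewrite /lie_bracket /cov_vect !derive_cst !add0r oppr0.
exact: subr0_eq.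
Qed.

(** Two covariant derivatives of a section of P stay in P, and by the Ricci identity their
    commutator is the curvature action. *)
Lemma fibre_curvature (i : chart at_) (x : 'cV[R]_m) (A : 'M[R]_m) u v :
  paraquaternionic_connection P D -> chart_image i x -> fibre P i x A ->
  let G := christoffel D i in
  fibre P i x (mxcomm (curvature (conn_form G x) (conn_form_deriv G x) u v) A).
Proof.
move=> Dpq cx PA G.
have oC : open (chart_image i) := @image_open _ _ _ at_ i.
have [U [J1 [J2 [J3 [[oU Ux UU] [S1 S2 S3 PJ]]]]]] := fibre_frame P cx.
have [_ spanx] := PJ x Ux; have [a [b [c AE]]] := (spanx A).1 PA.
(* Constant coefficients in a local frame extend [A] to a smooth section of P. *)
pose S y := a *: J1 y + b *: J2 y + c *: J3 y.
have PS y : U y -> fibre P i y (S y).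
  by move=> Uy; have [_ h] := PJ y Uy; apply/h; exists a, b, c.
have SS : smooth U S.
  have S0 := smooth_cst oU (0 : 'M[R]_m).
  have S3' := smooth_linear oU c S3 S0; have S2' := smooth_linear oU b S2 S3'.
  have S1' := smooth_linear oU a S1 S2'.
  by move=> k; apply: (eq_Ck oU _ (S1' k)) => y _; rewrite /S addr0 addrA.
have SG a' : smooth (chart_image i) (G^~ a') := christoffel_smooth D i a'.
have PD w := Dpq i U (cov_endo G w S) oU UU (smooth_cov_endo oC SG w oU UU SS)
  (fun y Uy => Dpq i U S oU UU SS PS y w Uy) x.
have /spanx[a1 [b1 [c1 E1]]] := PD v u Ux.
have /spanx[a2 [b2 [c2 E2]]] := PD u v Ux.
rewrite AE -/(S x) -(cov_endo_commutator SG u v oU UU SS Ux).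
apply/spanx; exists (a1 - a2), (b1 - b2), (c1 - c2).
by rewrite -/G in E1 E2; rewrite E1 E2; entrywise; ring.
Qed.

End ParaquaternionicCurvature.

(** * Integrability for both signs *)

Lemma structure_integrable_torsion_free (R : realType) (m : nat)
    (M : topologicalType) (at_ : atlas R m M)
    (P : paraquaternionic_structure at_) (D : linear_connection at_) (eps : R) :
  (4 < m)%N -> eps * eps = 1 -> torsion_free D ->
  paraquaternionic_connection P D -> structure_integrable P D eps.
Proof.
move=> m4 eps1 Dtf Dpq i W X Y oW SX SY _ _ s Ws.
move=> [cs [J1 [J2 [J3 [x [y [z [[pq span] AE qE]]]]]]]].
set G := christoffel D i; set A := s.2 in AE *.
have oC : open (chart_image i) := @image_open _ _ _ at_ i.
have SG a : smooth (chart_image i) (G^~ a) := christoffel_smooth D i a.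
have gs y' u v : chart_image i y' ->
  conn_form G y' u *m v = conn_form G y' v *m u := conn_form_symmetric u v Dtf.
have AA : A *m A = eps%:M by rewrite AE pq_square// qE.
have DG a u : derivable (G^~ a) s.1 u.
  exact: diff_derivable (smooth_differentiable (SG a) cs).
have DX w : derivable X s w.
  exact: diff_derivable (smooth_differentiable SX Ws).
have DY w : derivable Y s w.
  exact: diff_derivable (smooth_differentiable SY Ws).
rewrite (nijenhuis_bundle_struct DG DX DY (fun u v => gs s.1 u v cs) AA).
have m0 : (0 < m)%N by exact: leq_trans m4.
have eps0 : eps != 0.
  by apply: contraTneq (oner_neq0 R) => e0; rewrite -eps1 e0 mul0r eqxx.
have q0 : x ^+ 2 + y ^+ 2 - z ^+ 2 != 0 by rewrite qE.
have [B [dl [dl0 BB AB BK]]] := pq_orthogonal_generator m0 pq q0.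
rewrite -AE in AB BK.
rewrite (twisted_curvature_eq0 AA _ _ _ m4 eps1 dl0 BB AB) ?oppr0//.
- apply: curvature_linear => [|a u u' v|a u v v'].
  + exact: conn_form_linear.
  + exact: conn_form_deriv_linear_dir oC SG _ _ _ _ _ cs.
  + exact: conn_form_linear.
- exact: curvature_anti.
- apply: curvature_bianchi => u v; first exact: gs.
  move=> w; apply: (conn_form_deriv_symmetric oC SG) => // y' ?; exact: gs.
(* [S] lies in P by preservation under curvature and anticommutes with [A], so the generator [B]
   applies to it. *)
- move=> u v; set S := mxcomm _ A.
  have /span[k1 [k2 [k3 SE]]] : fibre P i s.1 S.
    by apply: fibre_curvature => //; apply/span; exists x, y, z.
  rewrite SE; apply: BK; rewrite -SE; exact: mxcomm_anticomm AA.
Qed.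

Theorem theorem6p13 (R : realType) (n : nat) (M : topologicalType)
    (hn : (8 <= 4 * n)%N)
    (M_hausdorff : hausdorff_space M) (M_countable : @second_countable M)
    (A : atlas R (4 * n) M) (P : paraquaternionic_structure A)
    (D : linear_connection A) (D_torsion_free : torsion_free D)
    (D_paraquaternionic : paraquaternionic_connection P D) :
  structure_integrable P D 1 /\ structure_integrable P D (- 1).
Proof.
(* This excludes dimension 4, where the factor [m - 4] of the trace argument is zero. *)
have m4 : (4 < 4 * n)%N by exact: leq_trans hn.
by split; apply: structure_integrable_torsion_free => //; rewrite ?mulrNN mulr1.
Qed.
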